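(* Let $G=\mathbb{Z}_{r_1}\times\mathbb{Z}_{r_2}\times\cdots\times\mathbb{Z}_{r_n}$, $V=G_{\varepsilon_1}\oplus G_{\varepsilon_2}\oplus\cdots\oplus G_{\varepsilon_n}$, $k\ge1$, and $Z_k(G)=\mathrm{End}_G(V^{\otimes k})$. For $\gamma=(\gamma_1,\dots,\gamma_k)\in[1,n]^k$ set $x(\gamma)=x_{\varepsilon_{\gamma_1}}\otimes\cdots\otimes x_{\varepsilon_{\gamma_k}}\in V^{\otimes k}$. Then the following hold: (i) For $c=(c_1,\dots,c_n)\in G$, a basis for the irreducible $Z_k(G)$-module $Z_k^c(G)\subseteq V^{\otimes k}$ is $$\Bigl\{x(\gamma)\;\Big|\;\gamma_i\in[1,n]\text{ for all }i\in[1,k],\text{ and }\textstyle\sum_{i=1}^k\varepsilon_{\gamma_i}=c\Bigr\}.$$ (ii) For all $a=(a_1,\dots,a_n)\in G$ and all $x(\gamma)$ in the basis in (i), the element $a$ acts on $x(\gamma)$ by the scalar $\chi_c(a)=\prod_{j=1}^n\omega_j^{a_jc_j}$, where $\omega_j=e^{2\pi i/r_j}$; thus $Z_k^c(G)$ is also a $G$-submodule of $V^{\otimes k}$, and it is the sum of all the copies of the irreducible $G$-module $G_c$ in $V^{\otimes k}$. (iii) For $\gamma,\beta\in[1,n]^k$ with $\sum_{i=1}^k\varepsilon_{\gamma_i}=\sum_{i=1}^k\varepsilon_{\beta_i}$ in $G$, let $E_\gamma^\beta\in\mathrm{End}(V^{\otimes k})$ be defined by $E_\gamma^\beta x(\alpha)=\delta_{\alpha,\gamma}\,x(\beta)$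 for $\alpha\in[1,n]^k$. Then $E_\vartheta^\eta E_\gamma^\beta=\delta_{\beta,\vartheta}E_\gamma^\eta$ for all such pairs $(\gamma,\beta)$ and $(\vartheta,\eta)$, and the $E_\gamma^\beta$ form a basis for $Z_k(G)$.
   Context: $r_1,\dots,r_n$ are positive integers, $\mathbb{Z}_r=\mathbb{Z}/r\mathbb{Z}$, and $[1,m]=\{1,\dots,m\}$. For $a\in G$, $G_a$ is the one-dimensional complex $G$-module with character $\chi_a(b)=\omega_1^{a_1b_1}\cdots\omega_n^{a_nb_n}$; these are all the irreducible $G$-modules. $\varepsilon_j\in G$ has $j$th component $1$ and all other components $0$, and $x_{\varepsilon_j}$ denotes a fixed basis vector of the $j$th summand $G_{\varepsilon_j}$ of $V$, so $x_{\varepsilon_1},\dots,x_{\varepsilon_n}$ is a basis of $V$. $Z_k^c(G)$ denotes the irreducible $Z_k(G)$-module labeled by $c$ via Schur–Weyl duality, i.e. by the bimodule decomposition $V^{\otimes k}\cong\bigoplus_cG_c\otimes Z_k^c(G)$ over those $c$ for which $G_c$ occurs in $V^{\otimes k}$; since $\dim G_c=1$, it is realized as the $Z_k(G)$-submodule of $V^{\otimes k}$ that is the corresponding summand (and is $0$ if $G_c$ does not occur). *)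

(* Defs.v *)
From HB Require Import structures.
From mathcomp Require Import all_boot all_order all_algebra complex.
From mathcomp Require Import reals trigo.

Set Implicit Arguments.
Unset Strict Implicit.
Unset Printing Implicit Defensive.

Import Order.TTheory GRing.Theory Num.Theory.
Local Open Scope ring_scope.

(* Z_{r_1} x ... x Z_{r_n}, written additively. The component Z_r is 'I_r for  *)
(* r > 0 (spelled 'I_r.-1.+1 to carry its additive group structure). The      *)
(* notation 'Z_r is avoided because 'Z_1 has two elements.                    *)
Definition Zprod (n : nat) (r : 'I_n -> nat) : Type :=
  {dffun forall j : 'I_n, 'I_(r j).-1.+1}.

HB.instance Definition _ n (r : 'I_n -> nat) := Finite.copy (Zprod r)
  {dffun forall j : 'I_n, 'I_(r j).-1.+1}.

Section ZprodZmodule.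
Variables (n : nat) (r : 'I_n -> nat).

Definition Zprod_mk (f : forall j : 'I_n, 'I_(r j).-1.+1) : Zprod r := finfun f.
Definition Zprod_fun (a : Zprod r) : forall j : 'I_n, 'I_(r j).-1.+1 :=
  fun j => fun_of_fin (a : {dffun forall j : 'I_n, 'I_(r j).-1.+1}) j.

Lemma Zprod_mkE f j : Zprod_fun (Zprod_mk f) j = f j.
Proof. by rewrite /Zprod_fun /Zprod_mk ffunE. Qed.

Lemma Zprod_eqP (a b : Zprod r) :
  (forall j, Zprod_fun a j = Zprod_fun b j) -> a = b.
Proof. by move=> eq_ab; apply/ffunP. Qed.

Definition Zprod0 := Zprod_mk (fun j => 0).
Definition Zprod_opp a := Zprod_mk (fun j => - Zprod_fun a j).
Definition Zprod_add a b := Zprod_mk (fun j => Zprod_fun a j + Zprod_fun b j).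

Lemma Zprod_addA : associative Zprod_add.
Proof. by move=> a b c; apply: Zprod_eqP => j; rewrite !Zprod_mkE addrA. Qed.
Lemma Zprod_addC : commutative Zprod_add.
Proof. by move=> a b; apply: Zprod_eqP => j; rewrite !Zprod_mkE addrC. Qed.
Lemma Zprod_add0 : left_id Zprod0 Zprod_add.
Proof. by move=> a; apply: Zprod_eqP => j; rewrite !Zprod_mkE add0r. Qed.
Lemma Zprod_addN : left_inverse Zprod0 Zprod_opp Zprod_add.
Proof. by move=> a; apply: Zprod_eqP => j; rewrite !Zprod_mkE addNr. Qed.

HB.instance Definition _ := GRing.isZmodule.Build (Zprod r)
  Zprod_addA Zprod_addC Zprod_add0 Zprod_addN.

(* If r j = 1 then the j-th component of eps j is 1 = 0 in Z_1.               *)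
Definition eps (j : 'I_n) : Zprod r :=
  Zprod_mk (fun i => if i == j then inord 1 else ord0).

End ZprodZmodule.
Coercion Zprod_fun : Zprod >-> Funclass.

Section Characters.
Variables (R : realType) (n : nat) (r : 'I_n -> nat).

(* e^{2 pi i / r_j}                                                           *)
Definition omega (j : 'I_n) : R[i] :=
  (cos (2 * pi / (r j)%:R) +i* sin (2 * pi / (r j)%:R))%C.

Definition chi (c a : Zprod r) : R[i] := \prod_(j < n) omega j ^+ (a j * c j).

Lemma cos_sin_exp (t : R) m :
  (cos t +i* sin t)%C ^+ m = (cos (m%:R * t) +i* sin (m%:R * t))%C.
Proof.
elim: m => [|m IHm]; first by rewrite expr0 mul0r cos0 sin0.
rewrite exprS IHm -natr1 mulrDl mul1r cosD sinD.
by apply/eqP; rewrite eq_complex /=; apply/andP; split; apply/eqP;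
  rewrite ?[cos t * _]mulrC ?[sin t * _]mulrC // addrC.
Qed.

Lemma omega_exp j : omega j ^+ (r j).-1.+1 = 1.
Proof.
rewrite /omega; case: (r j) => [|m] /=.
  by rewrite invr0 mulr0 cos0 sin0 expr1.
rewrite cos_sin_exp mulrC divfK ?pnatr_eq0 //.
by rewrite mulrC mulr_natr cos2pi sin2pi.
Qed.

Lemma chi0 c : chi c 0 = 1.
Proof. by rewrite /chi big1 // => j _; rewrite Zprod_mkE mul0n expr0. Qed.

Lemma chiD c a b : chi c (a + b) = chi c a * chi c b.
Proof.
rewrite /chi -big_split /=; apply: eq_bigr => j _.
rewrite !(mulnC _ (c j)) -exprD -mulnDr !(mulnC (c j)) !exprM; congr (_ ^+ _).
by rewrite Zprod_mkE /= expr_mod // omega_exp.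
Qed.

End Characters.

(* Finite-dimensional complex G-modules, G = Z_{r_1} x ... x Z_{r_n}.         *)
Record gmodule (R : realType) (n : nat) (r : 'I_n -> nat) := GModule {
  gsort :> vectType R[i];
  gact : Zprod r -> 'End(gsort);
  gact0 : gact 0 = \1%VF;
  gactD : forall a b, gact (a + b) = (gact a \o gact b)%VF }.
Arguments gact {R n r} _ _.

Section GModules.
Variables (R : realType) (n : nat) (r : 'I_n -> nat).
Local Notation C := R[i].
Implicit Types U W : gmodule R r.

Definition char_act (c a : Zprod r) : 'End(C^o) := chi R c a *: \1%VF.

Lemma char_act0 c : char_act c 0 = \1%VF.
Proof. by rewrite /char_act chi0 scale1r. Qed.

Lemma char_actD c a b :
  char_act c (a + b) = (char_act c a \o char_act c b)%VF.
Proof.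
by rewrite /char_act chiD -comp_lfunZl -comp_lfunZr comp_lfun1l scalerA.
Qed.

Definition Gchar (c : Zprod r) : gmodule R r :=
  GModule (char_act0 c) (char_actD c).

Definition defect U W (a : Zprod r) (f : 'Hom(U, W)) : 'Hom(U, W) :=
  (f \o gact U a)%VF - (gact W a \o f)%VF.

Lemma defect_is_linear U W a : linear (@defect U W a).
Proof.
move=> t f g; rewrite /defect comp_lfunDl comp_lfunDr -comp_lfunZl -comp_lfunZr.
by rewrite scalerBr opprD addrACA.
Qed.
HB.instance Definition _ U W a := GRing.isLinear.Build C _ _ _
  (@defect U W a) (@defect_is_linear U W a).

Definition HomG U W : {vspace 'Hom(U, W)} :=
  (\bigcap_(a : Zprod r) lker (linfun (@defect U W a)))%VS.

Lemma HomGP U W (f : 'Hom(U, W)) :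
  reflect (forall a, (f \o gact U a = gact W a \o f)%VF) (f \in HomG U W).
Proof.
rewrite memvE; apply: (iffP subv_bigcapP) => [fG a | fG a _].
  have := fG a isT; rewrite -memvE memv_ker lfunE subr_eq0 => /eqP; exact.
by rewrite -memvE memv_ker lfunE /= /defect fG subrr.
Qed.

Definition EndG W : {vspace 'End(W)} := HomG W W.

Definition gsubmodule W (M : {vspace W}) : Prop :=
  forall a : Zprod r, (gact W a @: M <= M)%VS.

Definition gcopy U W (M : {vspace W}) : Prop :=
  exists f : 'Hom(U, W), [/\ f \in HomG U W, lker f == 0%VS & limg f = M].

Definition is_sumv (W : vectType C) (P : {vspace W} -> Prop) (M : {vspace W})
    : Prop :=
  (forall N, P N -> (N <= M)%VS) /\
  (forall M', (forall N, P N -> (N <= M')%VS) -> (M <= M')%VS).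

(* The summand of W labelled by c in the (G, End_G(W))-bimodule decomposition *)
(* of W, that is the image of the canonical map                               *)
(* G_c (x) Hom_G(G_c, W) -> W, z (x) f |-> f z. As G_c = C, it is enough to   *)
(* evaluate at z = 1.                                                         *)
Definition schur_weyl W (c : Zprod r) : {vspace W} :=
  (linfun (fun f : 'Hom(Gchar c, W) => f (1 : C^o)) @: HomG (Gchar c) W)%VS.

Lemma schur_weylP W c (w : W) :
  reflect (exists2 f : 'Hom(Gchar c, W), f \in HomG (Gchar c) W & w = f (1 : C^o))
          (w \in schur_weyl W c).
Proof.
pose ev (f : 'Hom(Gchar c, W)) : W := f (1 : C^o).
have ev_lin : linear ev by move=> t f g; rewrite /ev add_lfunE scale_lfunE.
pose evL : {linear 'Hom(Gchar c, W) -> W} :=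
  HB.pack ev (GRing.isLinear.Build C _ _ _ ev ev_lin).
have evE f : linfun ev f = ev f by rewrite -[ev]/(evL : _ -> _) lfunE.
by apply: (iffP memv_imgP) => -[f fG ->]; exists f; rewrite ?evE.
Qed.

End GModules.
Arguments gcopy {R n r} U {W} M.

Section Modules.
Variables (F : fieldType) (W : vectType F) (A : {vspace 'End(W)}).

Definition stable_under (M : {vspace W}) : Prop :=
  forall f, f \in A -> (f @: M <= M)%VS.

Definition irreducible_under (M : {vspace W}) : Prop :=
  [/\ M != 0%VS, stable_under M &
      forall N : {vspace W}, (N <= M)%VS -> stable_under N ->
        N = 0%VS \/ N = M].

End Modules.

Section TensorPower.
Variables (F : fieldType) (k : nat).

Definition upd (V : Type) (v : {ffun 'I_k -> V}) (i : 'I_k) (u : V) :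
  {ffun 'I_k -> V} := [ffun l => if l == i then u else v l].

Definition multilinear (V W : vectType F) (f : {ffun 'I_k -> V} -> W) : Prop :=
  forall v i t u u',
    f (upd v i (t *: u + u')) = t *: f (upd v i u) + f (upd v i u').

(* T, with tens v = v_1 (x) ... (x) v_k, is the k-th tensor power of V.       *)
Definition tensor_power (V T : vectType F) (tens : {ffun 'I_k -> V} -> T)
    : Prop :=
  multilinear tens /\
  forall (W : vectType F) (f : {ffun 'I_k -> V} -> W), multilinear f ->
    exists! g : 'Hom(T, W), forall v, g (tens v) = f v.

End TensorPower.

Definition gtensor_power (R : realType) (n : nat) (r : 'I_n -> nat) (k : nat)
    (V T : gmodule R r) (tens : {ffun 'I_k -> V} -> T) : Prop :=
  tensor_power tens /\
  forall (a : Zprod r) (v : {ffun 'I_k -> V}),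
    gact T a (tens v) = tens [ffun i => gact V a (v i)].

(* V is the direct sum of the lines spanned by the x j, and the j-th line is  *)
(* a copy of G_{eps_j} in which x j is an arbitrary basis vector.             *)
Definition eps_sum (R : realType) (n : nat) (r : 'I_n -> nat)
    (V : gmodule R r) (x : n.-tuple V) : Prop :=
  basis_of fullv x /\
  forall (a : Zprod r) (j : 'I_n),
    gact V a (tnth x j) = chi R (eps r j) a *: tnth x j.

Section Words.
Variables (R : realType) (n : nat) (r : 'I_n -> nat) (k : nat).
Local Notation word := {ffun 'I_k -> 'I_n}.

Definition wt (g : word) : Zprod r := \sum_(i < k) eps r (g i).

Definition xword (V T : gmodule R r) (tens : {ffun 'I_k -> V} -> T)
    (x : n.-tuple V) (g : word) : T := tens [ffun i => tnth x (g i)].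

(* Only the values E g b with wt g = wt b are constrained (and used).         *)
Definition matrix_units (T : vectType R[i]) (X : word -> T)
    (E : word -> word -> 'End(T)) : Prop :=
  forall g b, wt g = wt b ->
    forall al, E g b (X al) = (al == g)%:R *: X b.

End Words.

(* A concrete model: coordinate vectors, with the entries of a pure tensor    *)
(* being the products of the entries of its factors.                          *)
Section Model.
Variables (R : realType) (n : nat) (r : 'I_n -> nat) (k : nat).
Local Notation C := R[i].
Local Notation word := {ffun 'I_k -> 'I_n}.

Section Diagonal.
Variables (I : finType) (ch : I -> Zprod r -> C).
Hypotheses (ch0 : forall l, ch l 0 = 1).
Hypotheses (chD : forall l a b, ch l (a + b) = ch l a * ch l b).

Definition diag_fun a (v : {ffun I -> C^o}) : {ffun I -> C^o} :=
  [ffun l => ch l a * v l].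

Lemma diag_fun_is_linear a : linear (diag_fun a).
Proof.
by move=> t u v; apply/ffunP => l; rewrite !ffunE /= mulrDr !scalerAr.
Qed.
HB.instance Definition _ a := GRing.isLinear.Build C _ _ _
  (diag_fun a) (diag_fun_is_linear a).

Definition diag_act a := linfun (diag_fun a).

Lemma diag_act0 : diag_act 0 = \1%VF.
Proof.
by apply/lfunP => v; rewrite !lfunE; apply/ffunP => l; rewrite ffunE ch0 mul1r.
Qed.

Lemma diag_actD a b : diag_act (a + b) = (diag_act a \o diag_act b)%VF.
Proof.
apply/lfunP => v; rewrite !lfunE /= !lfunE; apply/ffunP => l.
by rewrite !ffunE chD mulrA.
Qed.

Definition diag_gmodule : gmodule R r := GModule diag_act0 diag_actD.

Definition unit_vec (l : I) : {ffun I -> C^o} := [ffun l' => (l' == l)%:R].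

Lemma unit_vec_sum (v : {ffun I -> C^o}) : v = \sum_l v l *: unit_vec l.
Proof.
apply/ffunP => l; rewrite sum_ffunE (bigD1 l) //= big1 => [|l' /negPf ne].
  by rewrite !ffunE eqxx addr0 [_ *: _]mulr1.
by rewrite !ffunE eq_sym ne scaler0.
Qed.

End Diagonal.

Definition eps_chi (j : 'I_n) (a : Zprod r) : C := chi R (eps r j) a.
Definition word_chi (g : word) (a : Zprod r) : C := \prod_i eps_chi (g i) a.

Lemma word_chi0 g : word_chi g 0 = 1.
Proof. by rewrite /word_chi big1 // => i _; rewrite /eps_chi chi0. Qed.
Lemma word_chiD g a b : word_chi g (a + b) = word_chi g a * word_chi g b.
Proof. by rewrite -big_split; apply: eq_bigr => i _; rewrite /eps_chi chiD. Qed.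

Definition V_model : gmodule R r :=
  diag_gmodule (fun j => @chi0 R n r (eps r j)) (fun j => @chiD R n r (eps r j)).
Definition T_model : gmodule R r := diag_gmodule word_chi0 word_chiD.
Definition x_model : n.-tuple V_model := [tuple unit_vec j | j < n].
Definition tens_model (v : {ffun 'I_k -> V_model}) : T_model :=
  [ffun g : word => \prod_i (v i : {ffun 'I_n -> C^o}) (g i)].

Lemma eps_sum_model : eps_sum x_model.
Proof.
split=> [|a j]; last first.
  rewrite tnth_mktuple /= lfunE; apply/ffunP => l; rewrite !ffunE.
  by case: eqP => [->|_]; rewrite ?mulr0 ?scaler0.
rewrite basisEdim; apply/andP; split.
  apply/subvP=> v _; rewrite (unit_vec_sum v); apply: memv_suml => j _.
  apply: memvZ; apply: memv_span; apply/tnthP; exists j.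
  by rewrite tnth_mktuple.
by rewrite size_tuple dimvf -[X in (_ <= X)%N]/(#|'I_n| * 1)%N card_ord muln1.
Qed.

Lemma multilinear_ext0 (W : vectType C) (f : {ffun 'I_k -> V_model} -> W) :
  multilinear f -> (forall g : word, f [ffun i => unit_vec (g i)] = 0) ->
  forall v, f v = 0.
Proof.
move=> f_lin f0; pose isu (u : V_model) := exists j, u = unit_vec j.
suff IH m : forall v : {ffun 'I_k -> V_model},
    (forall i : 'I_k, (m <= i)%N -> isu (v i)) -> f v = 0.
  by move=> v; apply: (IH k) => i; rewrite leqNgt ltn_ord.
elim: m => [|m IHm] v v_u.
  have /fin_all_exists[g gP] i : exists j, v i = unit_vec j by apply: v_u.
  by rewrite -(f0 (finfun g)); congr f; apply/ffunP => i; rewrite !ffunE.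
have [lt_mk|le_km] := ltnP m k; last first.
  by apply: IHm => i /(leq_trans le_km); rewrite leqNgt ltn_ord.
pose i0 := Ordinal lt_mk.
have {1}-> : v = upd v i0 (v i0).
  by apply/ffunP => i; rewrite ffunE; case: eqP => [->|].
have f_upd0 : f (upd v i0 0) = 0.
  have := f_lin v i0 0 0 0; rewrite scaler0 addr0 scale0r add0r => e.
  by have := f_lin v i0 1 0 0; rewrite scaler0 addr0 scale1r => /eqP;
     rewrite -subr_eq subrr eq_sym => /eqP.
rewrite [v i0]unit_vec_sum.
elim/big_rec: _ => // j u _ IHu; rewrite f_lin IHu addr0.
rewrite IHm ?scaler0 // => i le_mi; rewrite ffunE; case: eqP => [_|/eqP ne].
  by exists j.
by apply: v_u; rewrite ltn_neqAle le_mi andbT eq_sym.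
Qed.

Lemma tens_model_unit (g : word) :
  tens_model [ffun i => unit_vec (g i)] = unit_vec g.
Proof.
apply/ffunP => h; rewrite !ffunE; case: eqP => [->|ne].
  by rewrite big1 // => i _; rewrite !ffunE eqxx.
have [i ne_i] : exists i, h i != g i.
  by apply/existsP; rewrite -negb_forall; apply/eqfunP => e; apply/ne/ffunP.
by rewrite (bigD1 i) //= !ffunE (negPf ne_i) mul0r.
Qed.

Lemma tens_model_multilinear : multilinear tens_model.
Proof.
move=> v i t u u'; apply/ffunP => g.
have prodE w : tens_model (upd v i w) g = (w : {ffun 'I_n -> C^o}) (g i) *
    \prod_(l < k | l != i) (v l : {ffun 'I_n -> C^o}) (g l).
  rewrite ffunE (bigD1 i) //= ffunE eqxx; congr (_ * _).
  by apply: eq_bigr => l /negPf ne; rewrite ffunE ne.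
by rewrite [RHS]ffunE [X in _ = X + _]ffunE !prodE !ffunE mulrDl scalerAl.
Qed.

Lemma gtensor_power_model : gtensor_power tens_model.
Proof.
split; last first.
  move=> a v; rewrite /= lfunE; apply/ffunP => g; rewrite !ffunE -big_split /=.
  by apply: eq_bigr => i _; rewrite ffunE lfunE /= ffunE.
split; first exact: tens_model_multilinear.
move=> W f f_lin.
pose h (w : T_model) : W :=
  \sum_(g : word) (w : {ffun word -> C^o}) g *: f [ffun i => unit_vec (g i)].
have h_lin : linear h.
  move=> t w w'; rewrite /h scaler_sumr -big_split /=; apply: eq_bigr => g _.
  by rewrite !ffunE scalerDl scalerA.
pose hL : {linear T_model -> W} :=
  HB.pack h (GRing.isLinear.Build C _ _ _ h h_lin).
have hE (g : word) :
    linfun hL (unit_vec g) = f [ffun i => unit_vec (g i)].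
  rewrite lfunE /= /h (bigD1 g) //= ffunE eqxx scale1r.
  by rewrite big1 ?addr0 // => l /negPf ne; rewrite ffunE ne scale0r.
exists (linfun hL); split=> [v | h' h'P].
  apply/eqP; rewrite -subr_eq0; apply/eqP.
  apply: (multilinear_ext0 (f := fun v => linfun hL (tens_model v) - f v)).
    move=> u i t w w'; rewrite tens_model_multilinear f_lin linearD linearZ /=.
    by rewrite opprD addrACA scalerBr.
  by move=> g; rewrite tens_model_unit hE subrr.
apply/lfunP => w; rewrite [w]unit_vec_sum !linear_sum; apply: eq_bigr => g _.
by rewrite !linearZ /= hE -h'P tens_model_unit.
Qed.

End Model.

(* Main.v *)
(* The group acts on x(gamma) by the character of weight wt(gamma), and       *)
(* distinct weights give distinct characters because omega_j is a primitive   *)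
(* r_j-th root of unity. Since the words x(gamma) form a basis, the isotypic  *)
(* part of G_c is spanned by the words of weight c, and an endomorphism       *)
(* commutes with G exactly when its matrix coefficients between words of      *)
(* different weights vanish. The remaining matrix units give the basis of     *)
(* Z_k(G), and they move any nonzero vector of the isotypic part to any       *)
(* basis word of that part, which gives irreducibility.                       *)
Require Import Defs.
From HB Require Import structures.
From mathcomp Require Import all_boot all_order all_algebra complex.
From mathcomp Require Import reals trigo ring.

Set Implicit Arguments.
Unset Strict Implicit.
Unset Printing Implicit Defensive.

Import Order.TTheory GRing.Theory Num.Theory.
Local Open Scope ring_scope.

(** Everything is read off in coordinates. The universal property gives functionals dual to the
    words x(gamma), so the words form a basis of the tensor power ([tensor_dual]), and G acts
    diagonally in it. By [mem_schur_weyl] the summand labelled c is the simultaneous eigenspace of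
    the character of c, and by [chi_inj] different labels give different characters; hence a vector
    of that summand has zero coordinate at every word of another weight ([schur_weyl_phi_eq0]). This
    yields [schur_weyl_basis]. An equivariant map keeps each word in its eigenspace, so the same
    vanishing applied to images of words yields [EndG_basis]. The rank-one maps [weight_unit]
    realize the matrix units, and they carry any nonzero vector of a summand to a nonzero multiple
    of any chosen basis word of it: [schur_weyl_irreducible]. *)

(** * Linear independence from dual functionals *)

Section DualFamily.
Variables (F : fieldType) (W : vectType F) (I : eqType) (X : I -> W).
Variable phi : I -> {linear W -> F^o}.
Hypothesis phiX : forall i j, phi i (X j) = (j == i)%:R.

Lemma span_dual_eq0 (i : I) (s : seq I) (w : W) :
  i \notin s -> w \in <<map X s>>%VS -> phi i w = 0.
Proof.
move=> i_s w_s.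
suff /subvP/(_ w w_s) : (<<map X s>> <= lker (linfun (phi i)))%VS.
  by rewrite memv_ker lfunE => /eqP.
apply/span_subvP => _ /mapP[j j_s ->]; rewrite memv_ker lfunE /= phiX.
by case: (j =P i) j_s i_s => [-> ->|].
Qed.

(** If [X i] were in the span of the other members, applying [phi i] would give 1 = 0. Allowing any
    duplicate-free [s] covers the words of a fixed weight and the pairs of words of equal weight. *)
Lemma free_dual (s : seq I) : uniq s -> free (map X s).
Proof.
elim: s => [|i s IHs] /=; first by rewrite nil_free.
case/andP=> i_s /IHs free_s; rewrite free_cons free_s andbT.
apply/negP => /(span_dual_eq0 i_s)/eqP.
by rewrite phiX eqxx oner_eq0.
Qed.

End DualFamily.

(** * Multilinear maps and the dual basis of a tensor power *)

Section Multilinear.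
Variables (F : fieldType) (V : vectType F) (k : nat).
Implicit Types (W : vectType F) (v : {ffun 'I_k -> V}).

Lemma multilinear0 W (f : {ffun 'I_k -> V} -> W) v i :
  multilinear f -> f (upd v i 0) = 0.
Proof.
move=> f_lin; have := f_lin v i 1 0 0.
by rewrite scaler0 addr0 scale1r => /eqP; rewrite -subr_eq subrr eq_sym => /eqP.
Qed.

Lemma upd_id v i : upd v i (v i) = v.
Proof. by apply/ffunP => l; rewrite ffunE; case: eqP => [->|]. Qed.

Lemma multilinearZ W (f : {ffun 'I_k -> V} -> W) v i a u :
  multilinear f -> f (upd v i (a *: u)) = a *: f (upd v i u).
Proof.
by move=> f_lin; have := f_lin v i a u 0; rewrite multilinear0 // !addr0.
Qed.

Lemma multilinear_prod W (f : {ffun 'I_k -> V} -> W) (a : 'I_k -> F) v :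
  multilinear f -> f [ffun i => a i *: v i] = (\prod_i a i) *: f v.
Proof.
move=> f_lin.
(* Only the slots in [s] are scaled, so induction on [s] pulls out one scalar at a time. *)
pose av (s : seq 'I_k) := [ffun i => if i \in s then a i *: v i else v i].
suff av_prod (s : seq 'I_k) : uniq s -> f (av s) = (\prod_(i <- s) a i) *: f v.
  rewrite -big_enum -av_prod ?enum_uniq //; congr f.
  by apply/ffunP => i; rewrite !ffunE mem_enum.
elim: s => [|i s IHs] /=.
  by rewrite big_nil scale1r => _; congr f; apply/ffunP => i; rewrite ffunE.
case/andP=> i_s /IHs; rewrite big_cons -scalerA => <-.
have -> : av (i :: s) = upd (av s) i (a i *: v i).
  by apply/ffunP => l; rewrite !ffunE in_cons; case: eqP => [->|].
rewrite multilinearZ // -[v i](_ : av s i = v i) ?upd_id //.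
by rewrite ffunE (negPf i_s).
Qed.

Lemma multilinear_basis_eq0 n (x : n.-tuple V) W (f : {ffun 'I_k -> V} -> W) :
    basis_of fullv x -> multilinear f ->
    (forall g : {ffun 'I_k -> 'I_n}, f [ffun i => tnth x (g i)] = 0) ->
  forall v, f v = 0.
Proof.
move=> x_basis f_lin f0; pose isx u := exists j, u = tnth x j.
(* The slots below [m] may hold arbitrary vectors: [m] = 0 is the hypothesis on basis words, [m] =
   [k] is the claim. The induction step expands slot [m] in the basis. *)
suff IH m : forall v : {ffun 'I_k -> V},
    (forall i : 'I_k, (m <= i)%N -> isx (v i)) -> f v = 0.
  by move=> v; apply: (IH k) => i; rewrite leqNgt ltn_ord.
elim: m => [|m IHm] v v_x.
  have /fin_all_exists[g gP] i : exists j, v i = tnth x j by apply: v_x.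
  by rewrite -(f0 (finfun g)); congr f; apply/ffunP => i; rewrite !ffunE.
have [lt_mk|le_km] := ltnP m k; last first.
  by apply: IHm => i /(leq_trans le_km); rewrite leqNgt ltn_ord.
pose i0 := Ordinal lt_mk.
rewrite -(upd_id v i0) (coord_basis x_basis (memvf (v i0))).
elim/big_rec: _ => [|j u _ IHu]; first exact: multilinear0.
rewrite f_lin IHu addr0 IHm ?scaler0 // => i le_mi.
rewrite ffunE; case: eqP => [_|/eqP ne].
  by exists j; rewrite (tnth_nth 0).
by apply: v_x; rewrite ltn_neqAle le_mi andbT eq_sym.
Qed.

Lemma prod_coord_multilinear n (x : n.-tuple V) (g : {ffun 'I_k -> 'I_n}) :
  multilinear (fun v => \prod_i coord x (g i) (v i) : F^o).
Proof.
move=> v i t u u'.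
have prodE w : \prod_l coord x (g l) (upd v i w l) =
    coord x (g i) w * \prod_(l < k | l != i) coord x (g l) (v l).
  rewrite (bigD1 i) //= ffunE eqxx; congr (_ * _).
  by apply: eq_bigr => l /negPf ne; rewrite ffunE ne.
by rewrite !prodE linearP mulrDl -mulrA.
Qed.

(* The functional dual to x(g) comes from the multilinear map                 *)
(* v |-> prod_i x_{g i}^*(v_i). The map t |-> sum_g phi_g(t) x(g) fixes every *)
(* pure tensor, hence is the identity by the uniqueness part of the universal *)
(* property.                                                                  *)
Lemma tensor_dual n (x : n.-tuple V) (T : vectType F)
    (tens : {ffun 'I_k -> V} -> T) :
    basis_of fullv x -> tensor_power tens ->
  let X (g : {ffun 'I_k -> 'I_n}) := tens [ffun i => tnth x (g i)] in
  exists phi : {ffun 'I_k -> 'I_n} -> 'Hom(T, F^o),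
    (forall g h, phi g (X h) = (h == g)%:R) /\
    (forall t, t = \sum_g phi g t *: X g).
Proof.
move=> x_basis [tens_lin tens_univ] X.
have ex_phi (g : {ffun 'I_k -> 'I_n}) : exists p : 'Hom(T, F^o),
    forall v, p (tens v) = \prod_i coord x (g i) (v i).
  by have [p [pP _]] := tens_univ _ _ (prod_coord_multilinear x g); exists p.
have {ex_phi} [phi phiP] := fin_all_exists ex_phi.
have phiX g h : phi g (X h) = (h == g)%:R.
  rewrite phiP; under eq_bigr => i _.
    rewrite ffunE (tnth_nth 0) coord_free ?(basis_free x_basis) //; over.
  case: eqP => [->|ne]; first by rewrite big1 // => i _; rewrite eqxx.
  have [i ne_i] : exists i, h i != g i.
    by apply/existsP; rewrite -negb_forall; apply/eqfunP => e; apply/ne/ffunP.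
  by rewrite (bigD1 i) //= (negPf ne_i) mul0r.
exists phi; split=> // t.
pose P t := \sum_g phi g t *: X g.
have P_lin : linear P.
  move=> a u v; rewrite /P scaler_sumr -big_split /=; apply: eq_bigr => g _.
  by rewrite linearP scalerDl scalerA.
pose PL : {linear T -> T} := HB.pack P (GRing.isLinear.Build F _ _ _ P P_lin).
have [q [_ q_uniq]] := tens_univ _ _ tens_lin.
have q_id : q = \1%VF by apply: q_uniq => v; rewrite id_lfunE.
rewrite -[LHS](id_lfunE t) -q_id (q_uniq (linfun PL)) ?lfunE // => v.
apply/eqP; rewrite lfunE -subr_eq0; apply/eqP.
apply: (multilinear_basis_eq0 (f := fun v => PL (tens v) - tens v) x_basis).
  by move=> w i a u u'; rewrite tens_lin linearP opprD addrACA scalerBr.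
move=> h; rewrite -/(X h) /= /P (bigD1 h) //= phiX eqxx scale1r.
rewrite big1 ?addr0 ?subrr // => g ne.
by rewrite phiX eq_sym (negPf ne) scale0r.
Qed.

End Multilinear.

(** * Distinct elements of G label distinct characters *)

Section CharacterTheory.
Variables (R : realType) (n : nat) (r : 'I_n -> nat).
Hypothesis r_gt0 : forall j, (0 < r j)%N.
Implicit Types a b c d : Zprod r.

(** The exponent a_j c_j is symmetric, so multiplicativity in the group element transfers to the
    label. *)
Lemma chiC c a : chi R c a = chi R a c.
Proof. by apply: eq_bigr => j _; rewrite mulnC. Qed.

Lemma chi_wt k (g : {ffun 'I_k -> 'I_n}) a :
  chi R (wt r g) a = \prod_i chi R (eps r (g i)) a.
Proof.
rewrite chiC (big_morph _ (chiD R a) (chi0 R a)).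
by apply: eq_bigr => i _; rewrite chiC.
Qed.

(** With y = pi m / r_j strictly between 0 and pi, the power has real part cos(2y) = 2 cos(y)^2 - 1.
    If this is 1, then cos(y)^2 = 1 and sin(y) = 0, against positivity of sine on that interval. *)
Lemma omega_exp_neq1 j m : (0 < m < r j)%N -> omega R r j ^+ m != 1.
Proof.
case/andP=> m_gt0 m_lt; rewrite cos_sin_exp; apply/eqP.
set y : R := pi * (m%:R / (r j)%:R).
have -> : m%:R * (2 * pi / (r j)%:R) = y *+ 2 :> R.
  by rewrite /y; ring.
have rj_gt0 : 0 < (r j)%:R :> R by rewrite ltr0n r_gt0.
have y_gt0 : 0 < y by rewrite mulr_gt0 ?pi_gt0 ?divr_gt0 ?ltr0n.
have y_lt : y < pi.
  by rewrite gtr_pMr ?pi_gt0 // ltr_pdivrMr // mul1r ltr_nat.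
case=> + _; rewrite cos_mulr2n => /eqP.
rewrite subr_eq -mulr2n eqrMn2r //= => /eqP cos1.
have /eqP := cos2Dsin2 y; rewrite cos1 -subr_eq0 addrAC subrr add0r sqrf_eq0.
by rewrite gt_eqF // sin_gt0_pi // y_gt0.
Qed.

Lemma omega_exp_inj j m p :
  (m < r j)%N -> (p < r j)%N -> omega R r j ^+ m = omega R r j ^+ p -> m = p.
Proof.
wlog le_mp : m p / (m <= p)%N => [IH|] m_lt p_lt eq_mp.
  by have [/IH|/ltnW/IH] := leqP m p; [apply|move=> H; apply/esym/H].
apply/eqP; rewrite eqn_leq le_mp leqNgt; apply/negP => lt_pm.
have om_neq0 : omega R r j != 0.
  apply/eqP => om0; have := omega_exp R r j.
  by rewrite om0 expr0n /= => /eqP; rewrite eq_sym oner_eq0.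
have /eqP[] : omega R r j ^+ (p - m) != 1.
  by rewrite omega_exp_neq1 // subn_gt0 lt_pm (leq_ltn_trans (leq_subr _ _)).
apply: (mulIf (expf_neq0 m om_neq0)).
by rewrite -exprD subnK // mul1r.
Qed.

(** Evaluating at [eps r j] isolates the power of omega_j whose exponent is the j-th component of
    the label. *)
Lemma chi_inj c d : (forall a, chi R c a = chi R d a) -> c = d.
Proof.
move=> eq_cd; apply: Zprod_eqP => j; apply: ord_inj.
have lt_r (u : Zprod r) : (u j < r j)%N.
  by rewrite -[X in (_ < X)%N](prednK (r_gt0 j)).
(* When r_j = 1 the entry 1 of [eps r j] collapses to 0 and evaluation says nothing, but then every
   j-th component is 0. *)
have [r1|r_gt1] := leqP (r j) 1.
  have u0 (u : Zprod r) : u j = 0%N :> nat.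
    by apply/eqP; rewrite -leqn0 -ltnS (leq_trans (lt_r u) r1).
  by rewrite !u0.
have chi_eps (u : Zprod r) : chi R u (eps r j) = omega R r j ^+ u j.
  rewrite /chi (bigD1 j) //= big1 => [|i /negPf ne].
    by rewrite Zprod_mkE eqxx inordK ?mulr1 ?mul1n // prednK.
  by rewrite Zprod_mkE ne mul0n.
by apply: omega_exp_inj; rewrite ?lt_r // -!chi_eps eq_cd.
Qed.

End CharacterTheory.

(** * Linear maps out of the ground field *)

Section LineMap.
Variables (F : fieldType) (W : vectType F) (u : W).

Definition line_fun (z : F^o) : W := z *: u.

Lemma line_fun_is_linear : linear line_fun.
Proof. by move=> a y z; rewrite /line_fun scalerDl scalerA. Qed.
HB.instance Definition _ := GRing.isLinear.Build F F^o W _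
  line_fun line_fun_is_linear.

Definition line_map : 'Hom(F^o, W) := linfun line_fun.

Lemma line_mapE z : line_map z = z *: u.
Proof. by rewrite lfunE. Qed.

End LineMap.

(** * Isotypic summands as simultaneous eigenspaces *)

Section Isotypic.
Variables (R : realType) (n : nat) (r : 'I_n -> nat).
Local Notation C := R[i].
Implicit Types (W : gmodule R r) (c : Zprod r).

Lemma hom_line W (f : 'Hom(C^o, W)) z : f z = z *: f (1 : C^o).
Proof. by rewrite -linearZ /= [_ *: _]mulr1. Qed.

Lemma GcharE c a z : gact (Gchar R c) a z = chi R c a *: z.
Proof. by rewrite /= scale_lfunE id_lfunE. Qed.

Lemma line_map_HomG W c (w : W) :
    (forall a, gact W a w = chi R c a *: w) ->
  (line_map w : 'Hom(Gchar R c, W)) \in HomG (Gchar R c) W.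
Proof.
move=> w_act; apply/HomGP => a; apply/lfunP => z.
by rewrite !comp_lfunE GcharE !line_mapE linearZ /= w_act !scalerA mulrC.
Qed.

(** A linear map out of the line G_c is determined by the image of 1, and it is equivariant exactly
    when G acts on that image through the character of c. *)
Lemma mem_schur_weyl W c (w : W) :
  reflect (forall a, gact W a w = chi R c a *: w) (w \in schur_weyl W c).
Proof.
apply: (iffP (schur_weylP c w)) => [[f fG ->] a|w_act].
  have /lfunP/(_ (1 : C^o)) := HomGP _ fG a.
  by rewrite !comp_lfunE GcharE linearZ.
by exists (line_map w); rewrite ?line_map_HomG // line_mapE scale1r.
Qed.

Lemma schur_weyl_gsubmodule W c : gsubmodule (schur_weyl W c).
Proof.
move=> a; apply/subvP => _ /memv_imgP[w w_c ->].
by rewrite (mem_schur_weyl _ _ w_c) memvZ.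
Qed.

(** A copy of G_c is a line spanned by an eigenvector, and conversely each nonzero eigenvector spans
    a copy. *)
Lemma schur_weyl_sum_copies W c :
  is_sumv (gcopy (Gchar R c)) (schur_weyl W c).
Proof.
split=> [_ [f [fG _ <-]]|M' M'P].
  apply/subvP => _ /memv_imgP[z _ ->]; rewrite hom_line memvZ //.
  by apply/schur_weylP; exists f.
apply/subvP => w /mem_schur_weyl w_act.
have [->|w_neq0] := eqVneq w 0; first exact: mem0v.
have w_line : w \in limg (line_map w).
  by rewrite -[X in X \in _]scale1r -line_mapE memv_img ?memvf.
apply: subvP w_line; apply: M'P; exists (line_map w).
split=> //; first exact: line_map_HomG.
apply/eqP/eqP/lker0P => y z; rewrite !line_mapE => /eqP.
by rewrite -subr_eq0 -scalerBl scaler_eq0 (negPf w_neq0) orbF subr_eq0 => /eqP.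
Qed.

(** Maps commuting with G preserve its simultaneous eigenspaces. *)
Lemma EndG_schur_weyl_stable W c : stable_under (EndG W) (schur_weyl W c).
Proof.
move=> f fG; apply/subvP => _ /memv_imgP[w w_c ->]; apply/mem_schur_weyl => a.
have /lfunP/(_ w) := HomGP _ fG a; rewrite !comp_lfunE => <-.
by rewrite (mem_schur_weyl _ _ w_c) linearZ.
Qed.

End Isotypic.

(** * Modules with a basis of weight vectors *)

Section WeightBasis.
Variables (R : realType) (n : nat) (r : 'I_n -> nat).
Hypothesis r_gt0 : forall j, (0 < r j)%N.
Local Notation C := R[i].
Variables (T : gmodule R r) (I : finType) (w : I -> Zprod r) (X : I -> T).
Variable phi : I -> 'Hom(T, C^o).
Hypothesis phiX : forall g h, phi g (X h) = (h == g)%:R.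
Hypothesis phi_sum : forall t, t = \sum_g phi g t *: X g.
Hypothesis actX : forall a g, gact T a (X g) = chi R (w g) a *: X g.

Lemma eq_lfun_basis (W : vectType C) (f f' : 'Hom(T, W)) :
  (forall g, f (X g) = f' (X g)) -> f = f'.
Proof.
move=> eq_ff'; apply/lfunP => t; rewrite (phi_sum t) !linear_sum.
by apply: eq_bigr => g _; rewrite !linearZ /= eq_ff'.
Qed.

Lemma phi_act g a t : phi g (gact T a t) = chi R (w g) a *: phi g t.
Proof.
rewrite -comp_lfunE -scale_lfunE; congr (fun_of_lfun _ t).
apply: eq_lfun_basis => h.
rewrite comp_lfunE scale_lfunE actX linearZ /= phiX.
by case: eqP => [->|]; rewrite ?scaler0.
Qed.

(** Computing [phi g] of a translate of [t] in two ways multiplies the same coordinate by the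
    characters of [w g] and of [c]. A nonzero coordinate would make these characters equal, hence
    the labels too. *)
Lemma schur_weyl_phi_eq0 c g t :
  t \in schur_weyl T c -> w g != c -> phi g t = 0.
Proof.
move=> /mem_schur_weyl t_act; apply: contraNeq => phi_neq0; apply/eqP.
apply: (chi_inj r_gt0) => a; apply: (mulIf phi_neq0).
by have := phi_act g a t; rewrite t_act linearZ.
Qed.

Lemma X_schur_weyl g c : w g = c -> X g \in schur_weyl T c.
Proof. by move=> <-; apply/mem_schur_weyl => a; apply: actX. Qed.

Lemma schur_weyl_basis c :
  basis_of (schur_weyl T c) [seq X g | g in [pred g | w g == c]].
Proof.
rewrite /basis_of (free_dual phiX) ?enum_uniq // andbT eqEsubv.
apply/andP; split.
  by apply/span_subvP => _ /imageP[g /eqP wg ->]; apply: X_schur_weyl.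
apply/subvP => t t_c; rewrite [t]phi_sum; apply: memv_suml => g _.
have [wg|wg] := eqVneq (w g) c; last first.
  by rewrite (schur_weyl_phi_eq0 t_c wg) scale0r mem0v.
by apply/memvZ/memv_span/imageP; exists g; rewrite ?inE ?wg.
Qed.

(** The matrix unit from [X g] to [X b], written as a rank-one map through the ground field. It is
    equivariant when the weights agree, since [phi g] and [X b] then scale by the same character. *)
Definition weight_unit g b : 'End(T) := (line_map (X b) \o phi g)%VF.

Lemma weight_unitE g b t : weight_unit g b t = phi g t *: X b.
Proof. by rewrite comp_lfunE line_mapE. Qed.

Lemma weight_unitX g b h : weight_unit g b (X h) = (h == g)%:R *: X b.
Proof. by rewrite weight_unitE phiX. Qed.

Lemma weight_unit_EndG g b : w g = w b -> weight_unit g b \in EndG T.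
Proof.
move=> wgb; apply/HomGP => a; apply/lfunP => t.
by rewrite !comp_lfunE !line_mapE phi_act linearZ /= actX -wgb !scalerA mulrC.
Qed.

(** A nonzero [t] in a stable [N] has a nonzero coordinate at some [g], necessarily of weight [c].
    The unit from [g] to [b] sends [t] to a nonzero multiple of [X b], so [N] contains every basis
    word of weight [c]. *)
Lemma schur_weyl_irreducible c :
  schur_weyl T c != 0%VS -> irreducible_under (EndG T) (schur_weyl T c).
Proof.
move=> Tc_neq0; split=> // [|N N_Tc N_st]; first exact: EndG_schur_weyl_stable.
have [->|N_neq0] := eqVneq N 0%VS; [by left | right].
apply/eqP; rewrite eqEsubv N_Tc /= -(span_basis (schur_weyl_basis c)).
apply/span_subvP => _ /imageP[b /eqP wb ->].
have t_N := memv_pick N; set t := vpick N in t_N.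
have t_neq0 : t != 0 by rewrite vpick0.
have /existsP[g phi_neq0] : [exists g, phi g t != 0].
  apply: contra_neqT t_neq0; rewrite negb_exists => /forallP phi0.
  by rewrite [t]phi_sum big1 // => g _; rewrite (eqP (negbNE (phi0 g))) scale0r.
have wg : w g = c.
  apply: contraNeq phi_neq0 => wg; apply/eqP.
  by apply: schur_weyl_phi_eq0 wg; apply: subvP N_Tc _ _.
have E_G : weight_unit g b \in EndG T by rewrite weight_unit_EndG // wg.
have : weight_unit g b t \in N.
  by apply: subvP (N_st _ E_G) _ _; apply: memv_img.
by rewrite weight_unitE rpredZeq (negPf phi_neq0).
Qed.

(** Schur's lemma in coordinates: [f] keeps [X g] in the eigenspace of weight [w g], where
    coordinates of other weights vanish. *)
Lemma EndG_phi_eq0 f g b : f \in EndG T -> w g != w b -> phi b (f (X g)) = 0.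
Proof.
move=> fG wgb; apply: schur_weyl_phi_eq0 (w g) _ _ _ _; last by rewrite eq_sym.
have /subvP := @EndG_schur_weyl_stable _ _ _ T (w g) f fG; apply.
exact/memv_img/X_schur_weyl.
Qed.

(** The first index is the source and the second the target, so that these functionals are dual to
    the family [weight_unit]. *)
Definition matrix_coef (p : I * I) (f : 'End(T)) : C^o := phi p.2 (f (X p.1)).

Lemma matrix_coef_is_linear p : linear (matrix_coef p).
Proof.
by move=> a f f'; rewrite /matrix_coef add_lfunE scale_lfunE linearP.
Qed.
HB.instance Definition _ p := GRing.isLinear.Build C _ _ _
  (matrix_coef p) (matrix_coef_is_linear p).

Lemma matrix_coef_unit p q :
  matrix_coef p (weight_unit q.1 q.2) = (q == p)%:R.
Proof.
rewrite /matrix_coef weight_unitX linearZ /= phiX -pair_eqE /= /pair_eq.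
rewrite [p.1 == _]eq_sym.
by do 2!case: eqP => _; rewrite ?scaler0 ?scale0r // scale1r.
Qed.

Lemma EndG_basis :
  basis_of (EndG T)
    [seq weight_unit p.1 p.2 | p : I * I in [pred p | w p.1 == w p.2]].
Proof.
have uniq_P := enum_uniq [pred p : I * I | w p.1 == w p.2].
rewrite /basis_of.
rewrite (free_dual (X := fun p => weight_unit p.1 p.2) matrix_coef_unit uniq_P).
rewrite andbT eqEsubv; apply/andP; split.
  by apply/span_subvP => _ /imageP[[g b] /eqP wgb ->]; apply: weight_unit_EndG.
apply/subvP => f fG.
(* This expansion holds for every endomorphism; equivariance enters only afterwards, to discard the
   pairs of unequal weight. *)
have -> : f = \sum_(p : I * I) matrix_coef p f *: weight_unit p.1 p.2.
  apply: eq_lfun_basis => h; rewrite sum_lfunE.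
  pose F g b := matrix_coef (g, b) f *: weight_unit g b (X h).
  rewrite [LHS]phi_sum (eq_bigr (fun p => F p.1 p.2)); last first.
    by move=> [g b] _; rewrite scale_lfunE.
  rewrite -(pair_bigA _ F) /= /F.
  rewrite [RHS](bigD1 h) //=.
  rewrite [X in _ = _ + X]big1 ?addr0 => [|g /negPf ne]; last first.
    by rewrite big1 // => b _; rewrite weight_unitX eq_sym ne scale0r scaler0.
  by apply: eq_bigr => b _; rewrite weight_unitX eqxx scale1r.
apply: memv_suml => -[g b] _.
have [wgb|wgb] := eqVneq (w g) (w b); last first.
  by rewrite /matrix_coef (EndG_phi_eq0 fG wgb) scale0r mem0v.
by apply/memvZ/memv_span/imageP; exists (g, b); rewrite ?inE /= ?wgb.
Qed.

End WeightBasis.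

(** * The tensor power as a module with a weight basis *)

Theorem theorem6p19 (R : realType) (n : nat) (r : 'I_n -> nat)
    (r_gt0 : forall j, (0 < r j)%N)
    (* V = G_{eps_1} (+) ... (+) G_{eps_n}, with basis x_{eps_j} *)
    (V : gmodule R r) (x : n.-tuple V) (V_sum : eps_sum x)
    (* T = V^{(x) k} *)
    (k : nat) (k_gt0 : (0 < k)%N)
    (T : gmodule R r) (tens : {ffun 'I_k -> V} -> T)
    (T_tens : gtensor_power tens) :
  (* (i) *)
  (forall c : Zprod r,
    [/\ stable_under (EndG T) (schur_weyl T c),
        schur_weyl T c != 0%VS ->
          irreducible_under (EndG T) (schur_weyl T c)
      & basis_of (schur_weyl T c)
          [seq xword tens x g |
            g : {ffun 'I_k -> 'I_n} in [pred g | wt r g == c]] ]) /\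
  (* (ii) *)
  (forall c : Zprod r,
    [/\ forall (a : Zprod r) (g : {ffun 'I_k -> 'I_n}), wt r g = c ->
          gact T a (xword tens x g) = chi R c a *: xword tens x g,
        gsubmodule (schur_weyl T c)
      & is_sumv (gcopy (Gchar R c)) (schur_weyl T c) ]) /\
  (* (iii) *)
  (forall g b : {ffun 'I_k -> 'I_n}, wt r g = wt r b ->
    exists! Egb : 'End(T), forall al : {ffun 'I_k -> 'I_n},
      Egb (xword tens x al) = (al == g)%:R *: xword tens x b) /\
  (forall E : {ffun 'I_k -> 'I_n} -> {ffun 'I_k -> 'I_n} -> 'End(T),
    matrix_units r (xword tens x) E ->
    (forall g b th et : {ffun 'I_k -> 'I_n},
      wt r g = wt r b -> wt r th = wt r et ->
      (E th et \o E g b)%VF = (b == th)%:R *: E g et) /\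
    basis_of (EndG T)
      [seq E p.1 p.2 |
        p : {ffun 'I_k -> 'I_n} * {ffun 'I_k -> 'I_n}
          in [pred p | wt r p.1 == wt r p.2]]).
Proof.
have [x_basis x_act] := V_sum; have [tens_univ tens_act] := T_tens.
set X := xword tens x.
have [phi [phiX phi_sum]] := tensor_dual x_basis tens_univ.
(* Each tensor factor is scaled by its own character; multilinearity collects the scalars, and their
   product is the character of the weight. *)
have actX a g : gact T a (X g) = chi R (wt r g) a *: X g.
  rewrite /X /xword tens_act chi_wt.
  pose y := [ffun i => tnth x (g i)].
  rewrite -(multilinear_prod (fun i => chi R (eps r (g i)) a) y tens_univ.1).
  by congr tens; apply/ffunP => i; rewrite !ffunE x_act.
split=> [c|].
  split; first exact: EndG_schur_weyl_stable.
    exact: (schur_weyl_irreducible r_gt0 phiX phi_sum actX).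
  exact: (schur_weyl_basis r_gt0 phiX phi_sum actX).
split=> [c|].
  split; first by move=> a g <-.
    exact: schur_weyl_gsubmodule.
  exact: schur_weyl_sum_copies.
split=> [g b _|E E_unit].
  exists (weight_unit X phi g b); split=> [h|f fE].
    exact: (weight_unitX phiX).
  apply: (eq_lfun_basis phi_sum) => h.
  by rewrite (weight_unitX phiX) -fE.
(* A family of matrix units is prescribed on all basis words, hence agrees with [weight_unit]
   wherever the weights match. *)
have EE g b : wt r g = wt r b -> E g b = weight_unit X phi g b.
  move=> wgb; apply: (eq_lfun_basis phi_sum) => h.
  by rewrite (weight_unitX phiX) E_unit.
split=> [g b th et wgb wte|].
  rewrite (EE th et) // (EE g b) //; apply/lfunP => t.
  rewrite comp_lfunE !weight_unitE linearZ /= phiX scale_lfunE.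
  have [bt|_] := eqVneq b th; last by rewrite scaler0 !scale0r.
  (* The product is indexed by ([g], [et]), whose weights agree through the common middle word [b] =
     [th]. *)
  rewrite EE; last by rewrite wgb bt.
  by rewrite weight_unitE scale1r [_ *: true%:R]mulr1.
rewrite (_ : image _ _ = [seq weight_unit X phi p.1 p.2 |
    p : {ffun 'I_k -> 'I_n} * {ffun 'I_k -> 'I_n}
      in [pred p | wt r p.1 == wt r p.2]]).
  exact: (EndG_basis r_gt0 phiX phi_sum actX).
by apply/eq_in_map => p; rewrite mem_enum => /eqP/EE.
Qed.
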